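(* For every integer $t \geq 2$, there is a constant $c'_t > 0$ (depending only on $t$) such that, for all sufficiently large integers $n$, \[ \chi_2(t; n) \geq c'_t\, \frac{\log^{(r-2)} n}{\log^{(r-1)} n}, \] where $r = 2^{t - 1}$.
   Context: $\mathrm{PG}(n-1,2)$ denotes the projective space of $\mathbb{F}_2^n$; its points are identified with the nonzero vectors of $\mathbb{F}_2^n$. A $(t-1)$-flat (i.e. a $(t-1)$-dimensional projective subspace) of $\mathrm{PG}(n-1,2)$ is the set of nonzero vectors of a $t$-dimensional linear subspace of $\mathbb{F}_2^n$. $\chi_2(t;n)$ is the smallest number of colors needed to color the points of $\mathrm{PG}(n-1,2)$ so that there is no monochromatic $(t-1)$-flat. $\log$ denotes the base-two logarithm, and the iterated logarithms are $\log^{(0)} n = n$ and $\log^{(i)} n = \log(\log^{(i-1)} n)$ for $i \geq 1$. *)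

(* Defs.v *)
From HB Require Import structures.
From mathcomp Require Import all_boot all_order all_algebra.
From mathcomp Require Import boolp reals exp.

Set Implicit Arguments.
Unset Strict Implicit.
Unset Printing Implicit Defensive.
Import Order.TTheory GRing.Theory Num.Theory.

Local Open Scope ring_scope.

Definition pg2_point (n : nat) := {v : 'rV['F_2]_n | v != 0}.

Definition flat_of (n : nat) (U : {vspace 'rV['F_2]_n}) : {set pg2_point n} :=
  [set x | val x \in U].

(* [d] is the projective dimension, hence the linear dimension is [d.+1]. *)
Definition is_flat (n d : nat) (F : {set pg2_point n}) : Prop :=
  exists2 U : {vspace 'rV['F_2]_n}, \dim U = d.+1 & F = flat_of U.

Definition monochromatic (n k : nat) (c : pg2_point n -> 'I_k)
    (F : {set pg2_point n}) : Prop :=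
  exists i : 'I_k, {in F, forall x, c x = i}.

Definition colorable (t n k : nat) : Prop :=
  exists c : pg2_point n -> 'I_k,
    forall F : {set pg2_point n}, is_flat t.-1 F -> ~ monochromatic c F.

Lemma colorable_ex (t n : nat) : (1 < t)%N -> exists k, `[< colorable t n k >].
Proof.
move=> t_gt1; exists #|{: pg2_point n}|; apply/asboolP.
exists enum_rank => F [U dimU defF] [i mono].
have ltU : (1 < \dim U)%N by rewrite dimU prednK // ltnW.
have inF (u : 'rV['F_2]_n) (uU : u \in U) (u0 : u != 0) :
    u = val (enum_val i : pg2_point n).
  have := mono (exist _ u u0); rewrite defF inE => /(_ uU) <-.
  by rewrite enum_rankK.
have U0 : U != 0%VS by rewrite -dimv_eq0 -lt0n ltnW.
have: (U <= <[vpick U]>)%VS.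
  apply/subvP => u uU; have [->|u0] := eqVneq u 0; first exact: mem0v.
  rewrite (inF u uU u0) -(inF _ (memv_pick U)) ?vpick0 //; exact: memv_line.
by move/dimvS; rewrite dim_vline vpick0 U0 leqNgt ltU.
Qed.

Definition chi2 (t : nat) (ht : (1 < t)%N) (n : nat) : nat :=
  ex_minn (colorable_ex n ht).

Definition log2 {R : realType} (x : R) : R := ln x / ln 2.

Definition iter_log2 {R : realType} (i : nat) (x : R) : R := iter i log2 x.

(* Main.v *)
(* Color a sequence of r = 2^(t-1) distinct vectors of F_2^n by the color of
   their sum (a zero sum getting a color of its own), and apply the hypergraph
   Ramsey theorem to find 2r-1 = 2^t-1 vectors all of whose r-subsets get the
   same color.  That color is not the one of zero sums.  Index the vectors x_v
   by the nonzero v in F_2^t: the sums y_a of the x_v with <a,v> = 1 have r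
   terms each and are linear in a, so that the nonzero y_a form a monochromatic
   (t-1)-flat.  Hence 2^n is less than the Ramsey number, which by the
   Erdos-Rado recursion is at most a tower of r-1 twos topped by O(k log k). *)
Require Import Defs.
From mathcomp Require Import all_boot all_order all_algebra.
From mathcomp Require Import boolp reals exp.
From mathcomp Require Import zify ring lra.

Set Implicit Arguments.
Unset Strict Implicit.
Unset Printing Implicit Defensive.
Import Order.TTheory GRing.Theory Num.Theory.

(** * The hypergraph Ramsey theorem by the Erdos-Rado recursion *)

Lemma pigeonhole (V : Type) (C : finType) (f : V -> C) (s : seq V) (m : nat) :
  (0 < #|C|)%N -> (#|C| * m <= size s)%N ->
  exists c, (m <= size [seq x <- s | f x == c])%N.
Proof.
move=> C_gt0 le_s.
have [/existsP[c hc]|] := boolP [exists c, m <= size [seq x <- s | f x == c]].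
  by exists c.
rewrite negb_exists => /forallP hC.
have e : size s = (\sum_(c : C) size [seq x <- s | f x == c])%N.
  under eq_bigr do rewrite size_filter -sum1_count.
  rewrite (exchange_big_dep xpredT) //= -sum1_size.
  by apply: eq_bigr => x _; rewrite (big_pred1 (f x)) // => c; rewrite eq_sym.
have : (size s < #|C| * m)%N.
  rewrite e -sum_nat_const.
  case/card_gt0P: C_gt0 => c0 _.
  rewrite (bigD1 c0) //= [in ltnRHS](bigD1 c0) //= -addSn.
  rewrite leq_add ?ltnNge ?hC // leq_sum // => c _.
  by rewrite ltnW // ltnNge hC.
by rewrite ltnNge le_s.
Qed.

Section EndHomogeneous.
Variables (V : eqType) (C : finType) (chi : seq V -> C) (r M : nat).

Let classes := {ffun r.-tuple 'I_M -> C}.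

(** The sequence [p] is built leftwards out of the reservoir [s]. The last hypothesis is the
    invariant: in front of a fixed [q] inside [p], all elements of [s] and all earlier terms of [p]
    give the same color. Once [j] terms have been moved, an element [z] left in the reservoir serves
    as a common substitute for first terms. *)
Lemma end_homogeneous_extend (j : nat) (s p : seq V) :
  (0 < #|C|)%N -> (size p + j = M)%N -> ((2 * #|classes|) ^ j <= size s)%N ->
  (forall q y z, size q = r.+1 -> subseq q p -> z \in s ->
     y \in s \/ subseq (y :: q) p -> chi (y :: q) = chi (z :: q)) ->
  exists p' z, [/\ subseq p' (s ++ p), size p' = M &
    forall q y, size q = r.+1 -> subseq (y :: q) p' ->
      chi (y :: q) = chi (z :: q)].
Proof.
move=> C_gt0; elim: j s p => [|j IHj] s p szp szs H.
  case: s szs H => // z s _ H; exists p, z; split.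
  - exact: suffix_subseq.
  - by rewrite -szp addn0.
  - move=> q y szq sub_q; apply: H => //; last by right.
      exact: subseq_trans (subseq_cons _ _) sub_q.
    by rewrite mem_head.
have cl_gt0 : (0 < #|classes|)%N by rewrite card_ffun expn_gt0 C_gt0.
case/lastP: s szs H => [|s x] szs H.
  by move: szs; rewrite leqn0 expn_eq0 muln_eq0 /= -[_ == 0]negbK -lt0n cl_gt0.
(* The new tuples [q] are those starting with [x]; the class of [y] records the colors of [y :: q]
   for all of them, the other [r] terms being given by positions in [p]. *)
pose f y : classes := [ffun u : r.-tuple 'I_M =>
  chi [:: y, x & [seq nth x p i | i : 'I_M <- u]]].
have [|c hc] := pigeonhole f (s := s) (m := (2 * #|classes|) ^ j) cl_gt0.
  (* The factor 2 in the bound on [size s] pays for the removal of [x]. *)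
  have : (0 < #|classes| * (2 * #|classes|) ^ j)%N.
    by rewrite !(muln_gt0, expn_gt0) cl_gt0.
  move: szs; rewrite size_rcons expnS -mulnA.
  by move: (#|_| * _)%N => P; lia.
set s' := [seq y <- s | f y == c] in hc.
have sub_s' : subseq s' s by apply: filter_subseq.
have s's y : y \in s' -> y \in rcons s x.
  by move=> /(mem_subseq sub_s') ys; rewrite mem_rcons inE ys orbT.
have [||p' [z [p'1 p'2 p'3]]] := IHj s' (x :: p) _ hc.
- by rewrite /= addSnnS.
- move=> q y z szq sub_q zs' hy.
  have [sub_qp|nsub_qp] := boolP (subseq q p).
    apply: H => //; first exact: s's.
    case: hy => [/s's|/=]; first by left.
    case: eqP => [-> _|_ ?]; last by right.
    by left; rewrite mem_rcons mem_head.
  have {hy}ys' : y \in s'.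
    case: hy => //= hy; case/negP: nsub_qp; move: hy.
    by case: eqP => // _; apply: subseq_trans (subseq_cons _ _).
  (* Now [q] starts with [x], and both [y] and [z] lie in the class [c]. *)
  case: q szq sub_q nsub_qp => //= x' q [szq].
  case: eqP => [-> sub_q _|_ -> //].
  have ltM v : v \in q -> (index v p < M)%N.
    move=> /(mem_subseq sub_q); rewrite -index_mem => /leq_trans; apply.
    by rewrite -szp leq_addr.
  have [u hu] : exists u : r.-tuple 'I_M,
      q = [seq nth x p i | i : 'I_M <- u].
    have M_gt0 : (0 < M)%N by rewrite -szp addnS.
    have szu : size [seq insubd (Ordinal M_gt0) (index v p) | v <- q] == r.
      by rewrite size_map szq.
    exists (Tuple szu) => /=; rewrite -map_comp -[LHS]map_id.
    apply/eq_in_map => v vq /=; rewrite val_insubd ltM // nth_index //.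
    exact: mem_subseq sub_q _ vq.
  have fc w : w \in s' -> f w = c by rewrite mem_filter => /andP[/eqP].
  have := fc z zs'; rewrite -(fc y ys') => /ffunP/(_ u).
  by rewrite !ffunE -hu.
- exists p', z; split=> //; apply: subseq_trans p'1 _.
  by rewrite cat_rcons; apply: cat_subseq.
Qed.

End EndHomogeneous.

(* For [i.+1]-uniform cliques of size [m] in [K] colors. *)
Fixpoint ramsey_bound (K m i : nat) : nat :=
  if i is i'.+1 then
    let M := ramsey_bound K m i' in ((2 * K ^ (M ^ i')) ^ M)%N
  else (K * m)%N.

(** On the end-homogeneous [p] the color of a tuple does not depend on its first term, which may be
    replaced by [z]; coloring the tails by [chi (z :: _)] lowers the uniformity by one. *)
Lemma ramsey (V : eqType) (C : finType) (m i : nat) (chi : seq V -> C)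
    (s : seq V) :
  (0 < #|C|)%N -> (ramsey_bound #|C| m i <= size s)%N ->
  exists (s' : seq V) (c : C), [/\ subseq s' s, size s' = m &
    forall q, size q = i.+1 -> subseq q s' -> chi q = c].
Proof.
move=> C_gt0; elim: i chi s => [|i IHi] chi s /= szs.
  have [c hc] := pigeonhole (fun x => chi [:: x]) C_gt0 szs.
  set w := filter _ _ in hc; exists (take m w), c; split.
  - exact: subseq_trans (take_subseq _ _) (filter_subseq _ _).
  - by rewrite size_takel.
  - case=> [|x []] //= _; rewrite sub1seq => /mem_take.
    by rewrite mem_filter => /andP[/eqP].
set M := ramsey_bound _ _ _ in szs.
have [||p [z [sub_p szp hp]]] :=
    @end_homogeneous_extend V C chi i M M s [::] C_gt0 erefl.
- by rewrite card_ffun card_tuple card_ord.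
- by case.
have [|s' [c [sub_s' szs' hs']]] := IHi (fun q => chi (z :: q)) p.
  by rewrite szp.
exists s', c; split=> //.
  by apply: subseq_trans sub_s' _; rewrite cats0 in sub_p.
case=> //= y q [szq] sub_q; rewrite hp //; last exact: subseq_trans sub_q _.
by apply: hs' => //; apply: subseq_trans (subseq_cons _ _) sub_q.
Qed.

(** * Tower estimates for the Ramsey bound *)

Definition tower (j x : nat) : nat := iter j (expn 2) x.

Lemma leq_tower j x y : (x <= y)%N -> (tower j x <= tower j y)%N.
Proof. by move=> le_xy; elim: j => //= j IHj; rewrite leq_exp2l. Qed.

Lemma leq_tower_id j x : (x <= tower j x)%N.
Proof.
by elim: j => //= j IHj; apply: leq_trans IHj _; rewrite ltnW // ltn_expl.
Qed.

(** A constant factor climbs to the top, since [c * 2 ^ a <= 2 ^ (c * a)] for positive [a] and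
    [c]. *)
Lemma leq_mul_tower c j x :
  (0 < c)%N -> (0 < x)%N -> (c * tower j x <= tower j (c * x))%N.
Proof.
move=> c_gt0 x_gt0; elim: j => //= j IHj.
apply: leq_trans (_ : 2 ^ (c * tower j x) <= _)%N; last by rewrite leq_exp2l.
have a_gt0 : (0 < tower j x)%N := leq_trans x_gt0 (leq_tower_id _ _).
case: c c_gt0 {IHj} => // c _; rewrite [in leqRHS]mulSn addnC expnD leq_mul2r.
apply/orP; right; apply: leq_trans (_ : 2 ^ c <= _)%N; first exact: ltn_expl.
by rewrite leq_exp2l // leq_pmulr.
Qed.

(** Here [l] is an integer stand-in for the logarithm of [K]. Each step of the recursion
    exponentiates a polynomial in the previous bound, and the polynomial only affects the constant
    [C] at the top. *)
Lemma ramsey_bound_tower (m i : nat) : (0 < m)%N ->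
  exists2 C : nat, (0 < C)%N & forall K l, (1 < K)%N -> (0 < l)%N ->
    (K <= 2 ^ l)%N -> (ramsey_bound K m i.+1 <= tower i.+1 (C * (K * l)))%N.
Proof.
move=> m_gt0.
have step K l i' : (1 < K)%N -> (0 < l)%N -> (K <= 2 ^ l)%N ->
    (ramsey_bound K m i'.+1 <= 2 ^ (2 * l * ramsey_bound K m i' ^ i'.+1))%N.
  move=> K_gt1 l_gt0 leK /=; set M := ramsey_bound K m i'.
  have M_gt0 : (0 < M)%N.
    rewrite /M; case: i' {M} => [|i'] /=; first by rewrite muln_gt0 m_gt0; lia.
    by rewrite expn_gt0 muln_gt0 expn_gt0; lia.
  apply: leq_trans (_ : (2 ^ (2 * l * M ^ i')) ^ M <= _)%N.
    rewrite leq_exp2r //; apply: leq_trans (_ : 2 * (2 ^ l) ^ (M ^ i') <= _)%N.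
      by rewrite leq_mul2l leq_exp2r // expn_gt0 M_gt0.
    rewrite -expnM -expnS leq_exp2l //.
    have : (0 < M ^ i')%N by rewrite expn_gt0 M_gt0.
    nia.
  by rewrite -expnM -mulnA -expnSr.
elim: i => [|i [C C_gt0 IHi]].
  exists (2 * m)%N => [|K l K_gt1 l_gt0 leK]; first by lia.
  apply: leq_trans (step K l 0 K_gt1 l_gt0 leK) _.
  by rewrite /= leq_exp2l // expn1; lia.
(* With [T] the previous tower, [i.+2] powers of [T] bound that of [M] and two more absorb [2 * l].
   As [T] is a power of two, this exponent becomes a factor one level down. *)
exists ((i.+2 + 2) * C)%N => [|K l K_gt1 l_gt0 leK]; first by lia.
apply: leq_trans (step K l i.+1 K_gt1 l_gt0 leK) _.
rewrite /tower iterS leq_exp2l // -/(tower _ _).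
have {IHi} := IHi K l K_gt1 l_gt0 leK; set M := ramsey_bound _ _ _ => leM.
have KL_gt0 : (0 < C * (K * l))%N by rewrite !muln_gt0 C_gt0 l_gt0; lia.
set T := tower i.+1 (C * (K * l)) in leM.
have le_lT : (2 * l <= T)%N.
  apply: leq_trans (leq_tower_id _ _); apply: leq_trans (leq_pmull _ C_gt0).
  by rewrite leq_mul2r K_gt1 orbT.
apply: leq_trans (_ : T ^ (i.+2 + 2) <= _)%N.
  rewrite [leqRHS]expnD mulnC leq_mul ?leq_exp2r //.
  apply: leq_trans (le_lT) _; rewrite expnS expn1 leq_pmulr //.
  by apply: leq_trans le_lT; rewrite muln_gt0.
rewrite /T /= -expnM leq_exp2l // mulnC -mulnA.
by apply: leq_mul_tower.
Qed.

(** * Linear algebra over the field with two elements *)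

Local Open Scope ring_scope.

Lemma F2_cases (x : 'F_2) : {x = 0} + {x = 1}.
Proof. by case: x => [[|[|x]] hx] //; [left|right]; apply/val_inj. Qed.

Lemma card_rV_F2 n : #|{: 'rV['F_2]_n}| = (2 ^ n)%N.
Proof. by rewrite card_mx card_Fp // mul1n. Qed.

(** Adding a unit vector on which [a] takes the value 1 exchanges the set with its complement, so
    each is half of the space. *)
Lemma card_affine_hyperplane (n : nat) (a : 'rV['F_2]_n) : a != 0 ->
  #|[set v : 'rV['F_2]_n | (a *m v^T) 0 0 == 1]| = (2 ^ n.-1)%N.
Proof.
move=> a0; pose phi (v : 'rV['F_2]_n) := (a *m v^T) 0 0.
have [i ai] : exists i, a 0 i = 1.
  case/rV0Pn: a0 => i hi; exists i; by case: (F2_cases (a 0 i)) hi => ->.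
have n_gt0 : (0 < n)%N by apply: leq_ltn_trans (ltn_ord i).
pose e : 'rV['F_2]_n := delta_mx 0 i.
have phiD v : phi (v + e) = phi v + 1.
  rewrite /phi linearD mulmxDr [LHS]mxE /e /= trmx_delta -colE.
  by rewrite [X in _ + X]mxE ai.
set A := [set v | _].
have cardC : #|~: A| = #|A|.
  rewrite -(card_imset (mem A) (addIr e)); congr #|pred_of_set _|.
  apply/setP => v; rewrite !inE; apply/idP/imsetP => [hv|[w]].
    exists (v - e); last by rewrite subrK.
    rewrite inE -/(phi _); move: hv; rewrite -/(phi v) -{1}(subrK e v) phiD.
    by case: (F2_cases (phi (v - e))) => ->; rewrite ?add0r ?eqxx.
  by rewrite inE -/(phi w) -/(phi v) => /eqP pw ->; rewrite phiD pw.
have := cardsC A; rewrite cardC card_rV_F2 addnn.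
rewrite (_ : 2 ^ n = (2 ^ n.-1).*2)%N; first exact: double_inj.
by rewrite -mul2n -expnS prednK.
Qed.

(* The summands are selected by the codewords of the simplex code. *)
Lemma simplex_sums (t n : nat) (s : seq 'rV['F_2]_n) :
  size s = (2 ^ t).-1 ->
  exists G : 'M['F_2]_(t, n), forall a : 'rV_t, a != 0 ->
    exists2 q, subseq q s & size q = (2 ^ t.-1)%N /\ \sum_(x <- q) x = a *m G.
Proof.
move=> szs; pose E := [seq v <- enum 'rV['F_2]_t | v != 0].
have uE : uniq E by rewrite filter_uniq ?enum_uniq.
have mE v : (v \in E) = (v != 0) by rewrite mem_filter mem_enum andbT.
have szE : size E = (2 ^ t).-1.
  rewrite -card_rV_F2 -(card_uniqP uE) [in RHS](cardD1 0) inE add1n /=.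
  by apply: eq_card => v; rewrite mE !inE andbT.
(* The terms of [s] are labelled by the nonzero vectors in the order of [E], so that filtering [E]
   selects a subsequence of [s]. *)
pose x v := nth 0 s (index v E).
have {szs}-> : s = map x E.
  apply: (@eq_from_nth _ 0); rewrite ?size_map szs // -szE => i lti.
  by rewrite (nth_map 0) // /x index_uniq.
(* Then [a *m G] is the sum of the [x v] with coefficients [<a,v>], each 0 or 1. *)
exists (\sum_(v <- E) v^T *m x v) => a a0.
exists (map x [seq v <- E | (a *m v^T) 0 0 == 1]).
  exact: map_subseq (filter_subseq _ _).
split.
  rewrite size_map -(card_affine_hyperplane a0).
  rewrite -(card_uniqP (filter_uniq _ uE)); apply: eq_card => v.
  rewrite [RHS]inE mem_filter mE andb_idr // => /eqP av.
  by apply: contra_eqN av => /eqP->; rewrite trmx0 mulmx0 mxE eq_sym oner_eq0.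
rewrite big_map big_filter mulmx_sumr big_mkcond.
apply: eq_bigr => v _; rewrite mulmxA (mx11_scalar (a *m v^T)) mul_scalar_mx.
rewrite mxE; by case: (F2_cases ((a *m v^T) 0 0)) => ->; rewrite ?scale1r ?scale0r.
Qed.


(** * From a homogeneous set to a monochromatic flat *)

Lemma colorable_bound (t n k : nat) : (1 < t)%N -> colorable t n k ->
  (2 ^ n < ramsey_bound k.+1 (2 ^ t).-1 (2 ^ (t - 1)).-1)%N.
Proof.
move=> t_gt1 [c hc]; rewrite ltnNge; apply/negP => le_n.
(* [insub] fails exactly on a zero sum, so [None] is the extra color and there are [k.+1] in all. *)
pose chi (q : seq 'rV['F_2]_n) : option 'I_k :=
  omap c (insub (\sum_(x <- q) x)).
have [||s [i [sub_s szs hs]]] :=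
    @ramsey _ _ (2 ^ t).-1 (2 ^ (t - 1)).-1 chi (enum 'rV['F_2]_n).
- by rewrite card_option.
- by rewrite card_option card_ord -cardE card_rV_F2.
rewrite prednK ?expn_gt0 // in hs.
have us : uniq s by apply: subseq_uniq sub_s _; apply: enum_uniq.
have Er : (2 ^ t = 2 * 2 ^ (t - 1))%N by rewrite -expnS; congr expn; lia.
have r_gt1 : (1 < 2 ^ (t - 1))%N by rewrite -{1}(expn0 2) ltn_exp2l //; lia.
case: i hs => [i|] hs; last first.
  (* Zero sums cannot be homogeneous: exchanging one term preserves the sum. *)
  have sum0 q : size q = (2 ^ (t - 1))%N -> subseq q s -> \sum_(x <- q) x = 0.
    by move=> szq /(hs q szq); rewrite /chi; case: insubP => //= /negbNE/eqP.
  case: s szs us sum0 {sub_s hs} => [|a [|b s]] szs us sum0.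
  - by move: szs => /=; lia.
  - by move: szs => /=; lia.
  move: us; rewrite /= inE negb_or => /andP[/andP[/eqP ab _] _]; apply: ab.
  (* As r = 2^(t-1) is at least 2, at least r-1 of the 2r-1 terms remain after [a] and [b]. *)
  set w := take (2 ^ (t - 1)).-1 s.
  have szw : (size w).+1 = (2 ^ (t - 1))%N.
    rewrite size_takel; first by rewrite prednK // ltnW.
    move: szs => /= szs; rewrite -(leq_add2r 2) !addn2 szs Er.
    by move: r_gt1; move: (2 ^ (t - 1))%N => r; lia.
  have sumw y : subseq (y :: w) [:: a, b & s] -> y + \sum_(x <- w) x = 0.
    by move=> sub_yw; have := sum0 (y :: w) szw sub_yw; rewrite big_cons.
  have sub_w : subseq w s := take_subseq _ _.
  apply: (addIr (\sum_(x <- w) x)); rewrite !sumw //.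
    apply: subseq_trans (subseq_cons _ _).
    exact: (@cat_subseq _ [:: b] w [:: b] s).
  apply: (@cat_subseq _ [:: a] w [:: a] (b :: s)) => //.
  exact: subseq_trans sub_w (subseq_cons _ _).
have [G hG] := simplex_sums szs.
have GP a : a != 0 -> exists2 p : pg2_point n, val p = a *m G & c p = i.
  move=> a0; have [q sub_q [szq sumq]] := hG a a0.
  have := hs q; rewrite subn1 in szq * => /(_ szq sub_q).
  rewrite /chi sumq; case: insubP => //= p _ pE [<-]; by exists p.
pose f : 'Hom('rV['F_2]_t, 'rV['F_2]_n) := linfun (mulmxr G).
apply: (hc (flat_of (limg f))).
  exists (limg f) => //; rewrite limg_dim_eq.
    by rewrite dimvf /dim /= mul1n prednK // ltnW.
  (* Injectivity: for nonzero [a], [GP] makes [a *m G] a point, hence nonzero. So the image has full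
     dimension [t]. *)
  apply/eqP; rewrite capfv; apply/eqP/vspaceP => a.
  rewrite memv_ker memv0 lfunE /=.
  apply/eqP/eqP => [aG|->]; last exact: mul0mx.
  apply/eqP; apply: contraT => /GP[p pE _].
  by case/eqP: (valP p); rewrite pE aG.
exists i => p; rewrite inE => /memv_imgP[a _]; rewrite lfunE /= => pa.
have a0 : a != 0.
  by apply: contraTneq (valP p) => a0; rewrite /= pa a0 mul0mx eqxx.
by have [p' p'E <-] := GP a a0; congr c; apply: val_inj; rewrite p'E -pa.
Qed.

(** * Iterated logarithms against towers *)

Lemma leq_log2 (R : realType) (x y : R) : 0 < x -> x <= y -> log2 x <= log2 y.
Proof.
move=> x_gt0 le_xy; have ln2 : (0 : R) < ln 2 by rewrite ln_gt0 // ltr1n.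
rewrite /log2 ler_pM2r ?invr_gt0 // ler_ln ?posrE //.
exact: lt_le_trans le_xy.
Qed.

Lemma log2_exp (R : realType) (n : nat) : log2 (2 ^+ n : R) = n%:R.
Proof.
have ln2 : (0 : R) < ln 2 by rewrite ln_gt0 // ltr1n.
by rewrite /log2 lnXn // -[X in X / _]mulr_natl mulfK // gt_eqF.
Qed.

Lemma iter_log2_le_tower (R : realType) (j B : nat) (x : R) :
  x <= (tower j B)%:R -> iter_log2 j x <= B%:R.
Proof.
elim: j x => // j IHj x le_x; rewrite /iter_log2 iterSr; apply: IHj.
(* At a nonpositive argument [ln] has the default value 0, which lies below every tower. *)
have [x_gt0|x_le0] := ltP 0 x; last by rewrite /log2 ln0 // mul0r.
by rewrite -log2_exp -natrX; apply: leq_log2.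
Qed.

Lemma tower_le_iter_log2 (R : realType) (j B : nat) (x : R) :
  (tower j B)%:R <= x -> B%:R <= iter_log2 j x.
Proof.
elim: j x => // j IHj x le_x; rewrite /iter_log2 iterSr; apply: IHj.
rewrite -log2_exp; apply: leq_log2; first by rewrite exprn_gt0.
by rewrite -natrX.
Qed.

(** * The lower bound for [chi2] *)

Lemma chi2_colorable (t : nat) (ht : (1 < t)%N) (n : nat) :
  colorable t n (chi2 ht n).
Proof. by rewrite /chi2; case: ex_minnP => k /asboolP. Qed.

Lemma colorable_gt0 (t n k : nat) : (0 < n)%N -> colorable t n k -> (0 < k)%N.
Proof.
case: n k => // n [|k] // _ [c _].
have v0 : (const_mx 1 : 'rV['F_2]_n.+1) != 0.
  by apply/rV0Pn; exists 0; rewrite mxE oner_eq0.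
by case: (c (exist (fun v : 'rV_n.+1 => v != 0) _ v0)).
Qed.

Theorem theorem1p3 (R : realType) (t : nat) (ht : (1 < t)%N) :
  let r := (2 ^ (t - 1))%N in
  exists2 c : R, 0 < c &
    exists N : nat, forall n : nat, (N <= n)%N ->
      c * (iter_log2 (r - 2)%N n%:R / iter_log2 (r - 1)%N n%:R)
        <= (chi2 ht n)%:R.
Proof.
move=> r.
have r_gt1 : (1 < r)%N by rewrite -{1}(expn0 2) ltn_exp2l //; lia.
have m_gt0 : (0 < (2 ^ t).-1)%N.
  by rewrite -subn1 subn_gt0 -{1}(expn0 2) ltn_exp2l //; lia.
have [C C_gt0 hC] := ramsey_bound_tower (r - 2) m_gt0.
have C_ge1 : 1 <= C%:R :> R by rewrite ler1n.
(* The 4 comes from [k + 1 <= 2 * k] and [l <= 2 * L] below. *)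
exists (4 * C%:R)^-1; first by rewrite invr_gt0; lra.
(* This threshold gives [X >= 4], and hence [L >= 1]. *)
exists (tower (r - 2) 4) => n le_n.
have n_gt0 : (0 < n)%N
  by apply: leq_trans le_n; apply: leq_trans (leq_tower_id _ _).
set k := chi2 ht n; have col_k : colorable t n k := chi2_colorable ht n.
have k_gt0 := colorable_gt0 n_gt0 col_k.
have k_ge1 : 1 <= k%:R :> R by rewrite ler1n.
have -> : (r - 1 = (r - 2).+1)%N by lia.
rewrite {2}/iter_log2 iterS -/(iter_log2 _ _).
set X : R := iter_log2 (r - 2) n%:R; set L := log2 X.
have X_ge4 : 4 <= X by apply: tower_le_iter_log2; rewrite ler_nat.
have L_ge1 : 1 <= L.
  have -> : 1 = log2 (2 ^+ 1) :> R by rewrite log2_exp.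
  by apply: leq_log2; rewrite ?expr1; lra.
rewrite mulrC ler_pdivrMr; last by lra.
rewrite ler_pdivrMr; last by lra.
(* If [X <= k + 1], the claim follows from [C >= 1] and [L >= 1]. Otherwise the logarithm of [k + 1]
   is at most [L], which lets [L] replace it in the Ramsey bound. *)
have [le_XK|lt_KX] := lerP X k.+1%:R.
  move: le_XK; rewrite -natr1 => le_XK.
  have h1 : k%:R * 4 <= k%:R * (4 * C%:R) :> R by apply: ler_wpM2l; lra.
  have h2 : k%:R * (4 * C%:R) <= k%:R * (4 * C%:R) * L :> R.
    by rewrite ler_peMr //; nra.
  lra.
have [l l_gt0 [L_l l_L]] : exists2 l, (0 < l)%N & L < l%:R /\ l%:R <= 2 * L.
  exists (Num.truncn L).+1 => //; split; first exact: truncnS_gt.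
  have : (Num.truncn L)%:R <= L by rewrite truncn_le; lra.
  by rewrite -natr1; lra.
have leK : (k.+1 <= 2 ^ l)%N.
  rewrite leqNgt; apply/negP => /ltnW; rewrite -(ler_nat R) natrX => le2.
  have : log2 (2 ^+ l) <= L.
    by apply: leq_log2 (le_trans le2 (ltW lt_KX)); rewrite exprn_gt0.
  by rewrite log2_exp leNgt L_l.
have := colorable_bound ht col_k; rewrite -/r.
have -> : (r.-1 = (r - 2).+1)%N by lia.
move=> /leq_trans/(_ (hC k.+1 l k_gt0 l_gt0 leK)).
(* The exponential in [2 ^ n] cancels the lowest level of the tower, leaving [r - 2] levels for the
   iterated logarithm to undo. *)
rewrite /tower iterS ltn_exp2l // -/(tower _ _) => /ltnW.
rewrite -(ler_nat R) => /iter_log2_le_tower; rewrite -/X !natrM -natr1 => leX.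
apply: le_trans leX _.
have -> : k%:R * (4 * C%:R) * L = C%:R * ((2 * k%:R) * (2 * L)) by ring.
by rewrite ler_pM2l ?ler_pM //; lra.
Qed.
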